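(* Let $\Gamma$ be a finite simple graph with at least two vertices such that no vertex of $\Gamma$ is adjacent to all other vertices. Then $\Gamma$ is (isomorphic to) the commuting graph of some semigroup $S$ with $|S|=|V(\Gamma)|+2$.
   Context: For a semigroup $S$ with centre $Z(S)=\{x\in S\mid xs=sx \text{ for all } s\in S\}$, the commuting graph $\Gamma(S)$ is the simple graph with vertex set $S\setminus Z(S)$ in which two distinct vertices $x,y$ are adjacent if and only if $xy=yx$. $V(\Gamma)$ denotes the vertex set of $\Gamma$. *)

(* Defs.v *)
From HB Require Import structures.
From mathcomp Require Import all_boot.

Set Implicit Arguments.
Unset Strict Implicit.
Unset Printing Implicit Defensive.

Local Open Scope group_scope.

Record sgraph := SGraph {
  vertex :> finType;
  adj : rel vertex;
  adj_sym : symmetric adj;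
  adj_irrefl : irreflexive adj
}.

Definition sgraph_iso (G H : sgraph) : Prop :=
  exists2 f : G -> H, bijective f & forall x y : G, adj (f x) (f y) = adj x y.

#[short(type="finSemigroupType")]
HB.structure Definition FinSemigroup := {S of Semigroup S & Finite S}.

Section CommutingGraph.
Variable S : finSemigroupType.

Definition semigroup_center : {set S} :=
  [set x | [forall s, x * s == s * x]].

Definition noncentral : finType := {x : S | x \notin semigroup_center}.

Definition commuting_adj : rel noncentral :=
  fun x y => (x != y) && (val x * val y == val y * val x).

Lemma commuting_adj_sym : symmetric commuting_adj.
Proof. by move=> x y; rewrite /commuting_adj eq_sym [val x * _ == _]eq_sym. Qed.

Lemma commuting_adj_irrefl : irreflexive commuting_adj.
Proof. by move=> x; rewrite /commuting_adj eqxx. Qed.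

Definition commuting_graph : sgraph :=
  SGraph commuting_adj_sym commuting_adj_irrefl.

End CommutingGraph.

(* Main.v *)
(* Adjoin two elements 0 and z to the vertex set.  All products lie in {0, z},
   and both of these annihilate everything (to 0), so every triple product is 0
   and associativity is automatic.  Hence the products of two vertices can be
   chosen freely in {0, z}: put x y = z exactly when x and y are distinct and
   non-adjacent and x comes before y in a fixed enumeration.  Then x and y
   commute iff they are equal or adjacent, and a vertex is central iff it is
   adjacent to all the others. *)
Require Import Defs.
From HB Require Import structures.
From mathcomp Require Import all_boot.

(* [inr false] is 0 and [inr true] is z. *)
Definition nilp_ext (G : sgraph) : Type := (G + bool)%type.

Section NilpotentExtension.
Variable G : sgraph.

HB.instance Definition _ := Finite.on (nilp_ext G).

Definition nilp_mul (a b : nilp_ext G) : nilp_ext G :=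
  match a, b with
  | inl x, inl y => inr (~~ adj x y && (enum_rank x < enum_rank y))
  | _, _ => inr false
  end.

Lemma nilp_mulA : associative nilp_mul.
Proof. by move=> [x|a] [y|b] [z|c]. Qed.

HB.instance Definition _ := hasMul.Build (nilp_ext G) nilp_mul.
HB.instance Definition _ := Magma_isSemigroup.Build (nilp_ext G) nilp_mulA.

Lemma nilp_commE (x y : G) :
  (nilp_mul (inl x) (inl y) == nilp_mul (inl y) (inl x)) =
  (x == y) || adj x y.
Proof.
rewrite /= (inj_eq inr_inj) [adj y x]adj_sym.
have [->|neq_xy] := eqVneq x y; first by rewrite eqxx.
case: (adj x y) => //=.
(* Non-adjacent [x] and [y] with distinct ranks have one product z and the other 0; equal ranks
   would force [x = y]. *)
by case: ltngtP => // /val_inj/enum_rank_inj/eqP; rewrite (negPf neq_xy).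
Qed.

Lemma nilp_centerP (a : nilp_ext G) :
  reflect (if a is inl x then forall y, y != x -> adj x y else True)
          (a \in semigroup_center (nilp_ext G)).
Proof.
rewrite inE; case: a => [x|b]; last first.
  by apply: (iffP forallP) => // _ [].
apply: (iffP forallP) => [central y|dom [y|b] //].
  by have := central (inl y); rewrite nilp_commE eq_sym => /orP[->|].
by rewrite nilp_commE; case: eqVneq => //= neq_xy; apply: dom; rewrite eq_sym.
Qed.

End NilpotentExtension.

Theorem theorem2p2 (G : sgraph) (hcard : 2 <= #|G|)
    (hdom : ~ exists x : G, forall y : G, y != x -> adj x y) :
  exists S : finSemigroupType,
    #|S| = #|G| + 2 /\ sgraph_iso G (commuting_graph S).
Proof.
exists (nilp_ext G); split; first by rewrite card_sum card_bool.
have noncentral_vertex (x : G) :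
    (inl x : nilp_ext G) \notin semigroup_center (nilp_ext G).
  by apply/nilp_centerP => dom; apply: hdom; exists x.
exists (fun x => Sub (inl x : nilp_ext G) (noncentral_vertex x)).
  (* No [inr b] is noncentral. The informative sigma type lets [sval] extract the inverse map. *)
  have to_vertex (a : commuting_graph (nilp_ext G)) : {x : G | val a = inl x}.
    case: a => -[x|b] /= nc; first by exists x.
    by case/nilp_centerP: nc.
  exists (fun a => sval (to_vertex a)) => [x|a].
    by case: (to_vertex _) => y /= [].
  by apply: val_inj => /=; case: (to_vertex a).
move=> x y; rewrite /= /commuting_adj -val_eqE /= (inj_eq inl_inj).
rewrite [X in _ && X]nilp_commE.
(* On the diagonal both sides are false, by irreflexivity of [adj]; off it the disjunct [x == y]
   drops out. *)
by case: eqVneq => [->|]; rewrite ?adj_irrefl.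
Qed.
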